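(* Let $C(t)=\frac{1-\sqrt{1-4t}}{2t}$, where $\sqrt{1-4t}$ is the formal power series in $t$ with constant term $1$. Then, as formal power series in $t$ with coefficients polynomial in $x$, the generating function of one-rooted plane trees $G_1(t,x)=\sum_{d=0}^\infty\sum_{e=d}^\infty T_1(e;d)\,x^d t^e$ is $$G_1(t,x) = \frac{1}{1-t \, x\,C(t)} = \frac{1 +\sqrt{1-4t}}{1+\sqrt{1-4t}-2x t }.$$
   Context: A plane tree with $e\ge1$ edges is a triple $\Gamma=(H,\alpha,\sigma)$, where $H$ is a set of $2e$ half-edges and $\alpha,\sigma$ are permutations of $H$ such that $\alpha$ is a fixed-point-free involution, the group generated by $\alpha,\sigma$ acts transitively on $H$, and $\sigma$ has exactly $e+1$ cycles (fixed points counted as cycles). Cycles of $\alpha$ are the edges, cycles of $\sigma$ are the vertices (with the cyclic order of half-edges around them), and the degree of a vertex is the length of its cycle. A one-rooted tree is a plane tree together with one chosen half-edge (the root); the vertex (cycle of $\sigma$) containing it is the root vertex. An isomorphism of one-rooted trees $(H,\alpha,\sigma)\to(H',\alpha',\sigma')$ is a bijection $\varphi:H\to H'$ with $\alpha=\varphi^{-1}\alpha'\varphi$, $\sigma=\varphi^{-1}\sigma'\varphi$, sending root to root. Isomorphic trees are identified. As an exceptional case, the graph with one vertex (of degree $0$) and no edges counts as the unique one-rooted tree with $e=0$. $T_1(e;d)$ is the number of one-rooted trees with $e$ edges whose root vertex has degree $d$; in particular $T_1(0;0)=1$. *)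

(* Defs.v *)
From HB Require Import structures.
From mathcomp Require Import all_boot all_order all_algebra all_fingroup.
From mathcomp Require Import boolp.

Set Implicit Arguments.
Unset Strict Implicit.
Unset Printing Implicit Defensive.

Import GRing.Theory.
Local Open Scope ring_scope.

Record fps (R : Type) := FPS { fps_coef : nat -> R }.
Coercion fps_coef : fps >-> Funclass.

HB.instance Definition _ (R : Type) := gen_eqMixin (fps R).
HB.instance Definition _ (R : Type) := gen_choiceMixin (fps R).

Lemma fpsP (R : Type) (a b : fps R) : a =1 b <-> a = b.
Proof.
split=> [|-> //]; case: a b => [a] [b] /= ab.
by congr FPS; apply/funext.
Qed.

Definition fps_const (R : nmodType) (c : R) : fps R :=
  FPS (fun n => if n == 0%N then c else 0).
Definition fps_add (R : nmodType) (a b : fps R) : fps R :=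
  FPS (fun n => a n + b n).
Definition fps_opp (R : zmodType) (a : fps R) : fps R :=
  FPS (fun n => - a n).
Definition fps_mul (R : pzRingType) (a b : fps R) : fps R :=
  FPS (fun n => \sum_(i < n.+1) a i * b (n - i)%N).

Fact fps_addA (R : zmodType) : associative (@fps_add R).
Proof. by move=> a b c; apply/fpsP => n /=; rewrite addrA. Qed.
Fact fps_addC (R : zmodType) : commutative (@fps_add R).
Proof. by move=> a b; apply/fpsP => n /=; rewrite addrC. Qed.
Fact fps_add0 (R : zmodType) : left_id (fps_const 0) (@fps_add R).
Proof. by move=> a; apply/fpsP => n /=; rewrite if_same add0r. Qed.
Fact fps_addN (R : zmodType) :
  left_inverse (fps_const 0) (@fps_opp R) (@fps_add R).
Proof. by move=> a; apply/fpsP => n /=; rewrite if_same addNr. Qed.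

HB.instance Definition _ (R : zmodType) := GRing.isZmodule.Build (fps R)
  (@fps_addA R) (@fps_addC R) (@fps_add0 R) (@fps_addN R).

Definition fps_trunc (R : nzRingType) n (a : fps R) : {poly R} :=
  \poly_(i < n) a i.

Lemma fps_mul_trunc (R : nzRingType) n m (a b : fps R) : (m < n)%N ->
  fps_mul a b m = (fps_trunc n a * fps_trunc n b)`_m.
Proof.
move=> mn; rewrite coefM /=; apply: eq_bigr => i _; rewrite !coef_poly.
by rewrite (leq_trans (ltn_ord i) mn) (leq_ltn_trans (leq_subr _ _) mn).
Qed.

Fact fps_mulA (R : comNzRingType) : associative (@fps_mul R).
Proof.
move=> a b c; apply/fpsP => n.
have tr (u v : fps R) m : (m < n.+1)%N ->
    (fps_trunc n.+1 (fps_mul u v))`_m = (fps_trunc n.+1 u * fps_trunc n.+1 v)`_m.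
  by move=> mn; rewrite coef_poly mn -fps_mul_trunc.
rewrite !(@fps_mul_trunc _ n.+1) //.
transitivity (fps_trunc n.+1 a * (fps_trunc n.+1 b * fps_trunc n.+1 c))`_n.
  rewrite !(coefM (fps_trunc n.+1 a)); apply: eq_bigr => i _.
  by rewrite tr // ltnS leq_subr.
rewrite mulrA [LHS]coefM [RHS]coefM; apply: eq_bigr => i _.
by rewrite tr.
Qed.

Fact fps_mulC (R : comNzRingType) : commutative (@fps_mul R).
Proof.
by move=> a b; apply/fpsP => n; rewrite !(@fps_mul_trunc _ n.+1) // mulrC.
Qed.

Fact fps_mul1 (R : comNzRingType) : left_id (fps_const 1) (@fps_mul R).
Proof.
move=> a; apply/fpsP => n /=; rewrite big_ord_recl /= subn0 mul1r.
by rewrite big1 ?addr0 // => i _; rewrite mul0r.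
Qed.

Fact fps_mulD (R : comNzRingType) :
  left_distributive (@fps_mul R) (@fps_add R).
Proof.
move=> a b c; apply/fpsP => n /=; rewrite -big_split /=.
by apply: eq_bigr => i _; rewrite mulrDl.
Qed.

Fact fps_1neq0 (R : comNzRingType) : fps_const (1 : R) != 0.
Proof.
by apply/eqP => /fpsP /(_ 0%N) /= /eqP; rewrite oner_eq0.
Qed.

HB.instance Definition _ (R : comNzRingType) :=
  GRing.Zmodule_isComNzRing.Build (fps R) (@fps_mulA R) (@fps_mulC R)
    (@fps_mul1 R) (@fps_mulD R) (@fps_1neq0 R).

Lemma fps_coefM (R : comNzRingType) (a b : fps R) n :
  (a * b) n = \sum_(i < n.+1) a i * b (n - i)%N.
Proof. by []. Qed.

Lemma fps_coefD (R : zmodType) (a b : fps R) n : (a + b) n = a n + b n.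
Proof. by []. Qed.

Lemma fps_coefN (R : zmodType) (a : fps R) n : (- a) n = - a n.
Proof. by []. Qed.

Lemma fps_coef1 (R : comNzRingType) n : (1 : fps R) n = (n == 0%N)%:R.
Proof. by case: n. Qed.

Lemma fps_coef_nat (R : comNzRingType) k n :
  (k%:R : fps R) n = if n == 0%N then k%:R else 0.
Proof.
elim: k => [|k IHk]; first by rewrite /= if_same.
rewrite -natr1 fps_coefD IHk fps_coef1.
by case: eqP => _; rewrite ?natr1 ?addr0.
Qed.

Lemma fps_coef0M (R : comNzRingType) (a b : fps R) :
  (a * b) 0%N = a 0%N * b 0%N.
Proof. by rewrite fps_coefM big_ord1. Qed.

(* The series whose n-th coefficient is F applied to the sequence of its first
   n coefficients. *)

Fixpoint fps_rec_seq (R : Type) (F : seq R -> R) n : seq R :=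
  if n is m.+1 then rcons (fps_rec_seq F m) (F (fps_rec_seq F m)) else [::].

Definition fps_rec (R : Type) (F : seq R -> R) : fps R :=
  FPS (fun n => F (fps_rec_seq F n)).

Lemma fps_rec_seqE (R : Type) (F : seq R -> R) n :
  fps_rec_seq F n = mkseq (fps_rec F) n.
Proof. by elim: n => //= n IHn; rewrite mkseqS -IHn. Qed.

Lemma fps_recE (R : Type) (F : seq R -> R) n :
  fps_rec F n = F (mkseq (fps_rec F) n).
Proof. by rewrite -fps_rec_seqE. Qed.

Definition fps_unit (R : comUnitRingType) : pred (fps R) :=
  fun a => a 0%N \is a GRing.unit.

(* From \sum_(k <= n) b_k a_(n - k) = [n = 0], solved for b_n. *)
Definition fps_inv (R : comUnitRingType) (a : fps R) : fps R :=
  if fps_unit a then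
    fps_rec (fun s => (a 0%N)^-1 *
      ((size s == 0)%:R - \sum_(k < size s) s`_k * a (size s - k)%N))
  else a.

Fact fps_mulVx (R : comUnitRingType) :
  {in @fps_unit R, left_inverse 1 (@fps_inv R) *%R}.
Proof.
move=> a ua; have ua0 : a 0%N \is a GRing.unit := ua.
apply/fpsP => n; rewrite fps_coefM fps_coef1 big_ord_recr /= subnn.
rewrite /fps_inv ifT //; set b := fps_rec _.
rewrite [b n]fps_recE size_mkseq mulrAC mulVr // mul1r.
rewrite addrC -addrA (eq_bigr (fun k : 'I_n => b k * a (n - k)%N)).
  by rewrite addNr addr0.
by move=> k _; rewrite nth_mkseq.
Qed.

Fact fps_unitPl (R : comUnitRingType) (a b : fps R) :
  b * a = 1 -> fps_unit a.
Proof.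
move=> /fpsP /(_ 0%N); rewrite fps_coef0M fps_coef1 /= => ba.
by apply/unitrP; exists (b 0%N); split; rewrite // mulrC.
Qed.

Fact fps_inv_out (R : comUnitRingType) :
  {in [predC @fps_unit R], @fps_inv R =1 id}.
Proof. by move=> a; rewrite inE /fps_inv -topredE /= => /negbTE->. Qed.

HB.instance Definition _ (R : comUnitRingType) :=
  GRing.ComNzRing_hasMulInverse.Build (fps R) (@fps_mulVx R) (@fps_unitPl R)
    (@fps_inv_out R).

Lemma fps_unitE (R : comUnitRingType) (a : fps R) :
  (a \is a GRing.unit) = (a 0%N \is a GRing.unit).
Proof. by []. Qed.

(* The square root with constant term 1 of a series with constant term 1, when
   2 is invertible: \sum_(k <= n) s_k s_(n - k) = a_n, solved for s_n. *)
Definition fps_sqrt (R : comUnitRingType) (a : fps R) : fps R :=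
  fps_rec (fun s =>
    let n := size s in
    if n == 0%N then 1
    else (a n - \sum_(1 <= k < n) s`_k * s`_(n - k)) / 2%:R).

Lemma fps_sqrt0 (R : comUnitRingType) (a : fps R) : fps_sqrt a 0%N = 1.
Proof. by []. Qed.

Lemma fps_sqr_sqrt (R : comUnitRingType) (a : fps R) :
  (2%:R : R) \is a GRing.unit -> a 0%N = 1 -> fps_sqrt a ^+ 2 = a.
Proof.
move=> u2 a0; have s0 := fps_sqrt0 a.
have sS n : fps_sqrt a n.+1 =
    (a n.+1 - \sum_(i < n) fps_sqrt a i.+1 * fps_sqrt a (n - i)%N) / 2%:R.
  rewrite {1}/fps_sqrt fps_recE size_mkseq -/(fps_sqrt a).
  congr ((_ - _) / _); rewrite big_add1 big_mkord; apply: eq_bigr => i _.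
  by rewrite subSS !nth_mkseq // ltnS ?leq_subr // ltnW.
move: (fps_sqrt a) s0 sS => s s0 sS; apply/fpsP => -[|n].
  by rewrite expr2 fps_coef0M s0 mulr1 a0.
rewrite expr2 fps_coefM big_ord_recl big_ord_recr subn0 subnn s0 mul1r mulr1.
rewrite sS (eq_bigr (fun i : 'I_n => s i.+1 * s (n - i)%N)) //.
rewrite addrCA -mulr2n -[_ *+ 2]mulr_natr divrK //.
by rewrite addrC subrK.
Qed.

Lemma fps_sqrt_uniq (R : comUnitRingType) (a s : fps R) :
  (2%:R : R) \is a GRing.unit -> s 0%N = 1 -> s ^+ 2 = a -> s = fps_sqrt a.
Proof.
move=> u2 s0 sa.
have a0 : a 0%N = 1 by rewrite -sa expr2 fps_coef0M s0 mulr1.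
apply/eqP; rewrite -subr_eq0; apply/eqP.
have u : s + fps_sqrt a \is a GRing.unit.
  by rewrite fps_unitE fps_coefD s0 fps_sqrt0 -mulr2n.
by apply: (mulIr u); rewrite -subr_sqr sa fps_sqr_sqrt // subrr mul0r.
Qed.

Definition fps_var (R : comNzRingType) : fps R := FPS (fun n => (n == 1%N)%:R).

(* Division by the variable, meaningful for series with constant term 0. *)
Definition fps_divt (R : Type) (a : fps R) : fps R := FPS (fun n => a n.+1).

Lemma fps_mul_divt (R : comNzRingType) (a : fps R) :
  a 0%N = 0 -> fps_var R * fps_divt a = a.
Proof.
move=> a0; apply/fpsP => -[|n]; first by rewrite fps_coef0M mul0r a0.
rewrite fps_coefM !big_ord_recl /= mul0r add0r mul1r subn1 /= big1 ?addr0 //.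
by move=> i _; rewrite mul0r.
Qed.

(* We work in Q[x][[t]] rather than Z[x][[t]] so that 2 is invertible. *)

Definition tvar : fps {poly rat} := fps_var {poly rat}.
Definition xvar : fps {poly rat} := fps_const 'X.

Definition sqrt_1_4t : fps {poly rat} := fps_sqrt (1 - 4%:R * tvar).

Definition catalan : fps {poly rat} := fps_divt ((1 - sqrt_1_4t) / 2%:R).

Lemma poly_rat2_unit : (2%:R : {poly rat}) \is a GRing.unit.
Proof. by rewrite -polyC_natr poly_unitE size_polyC coefC. Qed.

Lemma fps2_unit : (2%:R : fps {poly rat}) \is a GRing.unit.
Proof. by rewrite fps_unitE fps_coef_nat poly_rat2_unit. Qed.

Lemma sqrt_1_4t_sqr : sqrt_1_4t ^+ 2 = 1 - 4%:R * tvar.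
Proof.
apply: fps_sqr_sqrt; first exact: poly_rat2_unit.
by rewrite fps_coefD fps_coefN fps_coef0M mulr0 subr0.
Qed.

Lemma catalanE : 2%:R * tvar * catalan = 1 - sqrt_1_4t.
Proof.
rewrite -mulrA fps_mul_divt.
  by rewrite mulrCA mulrV ?mulr1 // fps2_unit.
by rewrite fps_coef0M fps_coefD fps_coefN fps_sqrt0 subrr mul0r.
Qed.

Lemma denom1_unit : 1 - tvar * xvar * catalan \is a GRing.unit.
Proof.
by rewrite fps_unitE fps_coefD fps_coefN !fps_coef0M !mul0r subr0 unitr1.
Qed.

Lemma denom2_unit : 1 + sqrt_1_4t - 2%:R * xvar * tvar \is a GRing.unit.
Proof.
rewrite fps_unitE !fps_coefD fps_coefN fps_coef0M mulr0 subr0 fps_sqrt0.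
by rewrite fps_coef1 -mulr2n poly_rat2_unit.
Qed.

(* H is the set of half-edges; porbits counts fixed points as cycles. *)
Definition plane_tree (H : finType) (e : nat) (alpha sigma : {perm H}) : bool :=
  [&& (0 < e)%N,
      #|H| == (2 * e)%N,
      [forall h, (alpha (alpha h) == h) && (alpha h != h)],
      [transitive <<[set alpha; sigma]>>%g, on [set: H] | 'P]
    & #|porbits sigma| == e.+1].

(* (alpha, sigma, root) *)
Definition rooted_map (H : finType) : Type := ({perm H} * {perm H} * H)%type.

HB.instance Definition _ (H : finType) := Finite.on (rooted_map H).

Definition one_rooted_tree (H : finType) (e : nat) (T : rooted_map H) : bool :=
  let: (alpha, sigma, _) := T in plane_tree e alpha sigma.

Definition root_degree (H : finType) (T : rooted_map H) : nat :=
  let: (_, sigma, r) := T in #|porbit sigma r|.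

Definition rooted_iso (H H' : finType) (T : rooted_map H) (T' : rooted_map H') :
    Prop :=
  let: (alpha, sigma, r) := T in
  let: (alpha', sigma', r') := T' in
  exists2 phi : H -> H', bijective phi &
    [/\ forall h, phi (alpha h) = alpha' (phi h),
        forall h, phi (sigma h) = sigma' (phi h)
      & phi r = r'].

Lemma rooted_iso_refl (H : finType) (T : rooted_map H) : rooted_iso T T.
Proof. by case: T => [[al si] r]; exists id => //; exists id. Qed.

Lemma rooted_iso_sym (H H' : finType) (T : rooted_map H) (T' : rooted_map H') :
  rooted_iso T T' -> rooted_iso T' T.
Proof.
case: T T' => [[al si] r] [[al' si'] r'] [f [g fK gK] [fa fs fr]].
exists g; first by exists f.
by split=> [h|h|]; rewrite -?fr ?fK // -{1}(gK h) -?fa -?fs fK.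
Qed.

Lemma rooted_iso_trans (H H' H'' : finType) (T : rooted_map H)
    (T' : rooted_map H') (T'' : rooted_map H'') :
  rooted_iso T T' -> rooted_iso T' T'' -> rooted_iso T T''.
Proof.
case: T T' T'' => [[al si] r] [[al' si'] r'] [[al'' si''] r''].
move=> [f bf [fa fs fr]] [g bg [ga gs gr]].
exists (g \o f); first exact: bij_comp.
by split=> [h|h|] /=; rewrite ?fa ?fs ?fr.
Qed.

(* Every rooted map on n half-edges has an isomorphic copy on 'I_n, so it is
   enough to count isomorphism classes there. *)
Lemma rooted_iso_ord (H : finType) n (T : rooted_map H) : #|H| = n ->
  exists T' : rooted_map 'I_n, rooted_iso T T'.
Proof.
case: T => [[al si] r] <-.
have inj (p : {perm H}) :
    injective (fun i : 'I_#|H| => enum_rank (p (enum_val i))).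
  by move=> i j /enum_rank_inj /perm_inj /enum_val_inj.
exists (perm (inj al), perm (inj si), enum_rank r); exists enum_rank.
  exact: enum_rank_bij.
by split=> // h; rewrite permE enum_rankK.
Qed.

(* The number of isomorphism classes; for e = 0 only the one-vertex graph
   counts, and its root vertex has degree 0. *)
Definition T1 (e d : nat) : nat :=
  if e == 0%N then nat_of_bool (d == 0%N)
  else #|equivalence_partition
           (fun T T' : rooted_map 'I_(2 * e) => `[< rooted_iso T T' >])
           [set T : rooted_map 'I_(2 * e) |
              one_rooted_tree e T & root_degree T == d]|.

(* \sum_d \sum_(e >= d) T1(e; d) x^d t^e, collected by powers of t. *)
Definition G1 : fps {poly rat} :=
  FPS (fun e => \sum_(d < e.+1) (T1 e d)%:R *: 'X^d).

(* Main.v *)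
Require Import Defs.
From HB Require Import structures.
From mathcomp Require Import all_boot all_order all_algebra all_fingroup.
From mathcomp Require Import boolp zify ring.

Set Implicit Arguments.
Unset Strict Implicit.
Unset Printing Implicit Defensive.

(** One-rooted plane trees are counted by walking around them.

    In a map [(H, alpha, sigma)] the face permutation is [alpha * sigma], i.e.
    [h |-> sigma (alpha h)].  Start from [sigma], which has [e + 1] cycles, and
    multiply by the [e] transpositions of [alpha] one at a time.  Each step
    changes the number of cycles by one, and since the map is connected while
    [e] merges are needed to join [e + 1] cycles, no step can be wasted: every
    one of them merges, so a tree has a single face ([connected_porbits],
    [tree_face]).  The iterates of the face permutation from the root
    therefore label the half-edges by [0, ..., 2e - 1]; this labelling is
    canonical, so a rooted tree up to isomorphism is the same thing as the
    fixed-point-free involution that [alpha] becomes on the labels.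

    Read backwards, [sigma] is obtained from the one-cycle face permutation by
    multiplying by [e] transpositions, and it reaches [e + 1] cycles only if
    each of them splits a cycle; hence no two arches of the involution cross
    ([tree_noncrossing]).  Noncrossing matchings correspond to binary trees by
    the first-return decomposition: the arch of [0] encloses the matching coded
    by the left subtree and is followed by the one coded by the right subtree
    ([matching], [matching_surj]).  Conversely the matching of a binary tree
    does define a plane tree, because the corners around the contour can be
    labelled by [e + 1] vertices so that [sigma] preserves the labels
    ([corner_matching], [codes_tree]); the corners at the root are the starts of
    the outermost arches, so the root degree is the length of the right spine
    ([count_root_corner]).

    So [T1 e d] is the number of binary trees with [e] nodes and spine [d]
    ([T1_count]).  Splitting a binary tree at its root gives
    [G1 = 1 + t x C G1] ([G1_eq]), where the size of the left subtree is
    recorded by the Catalan series, the solution of [C = 1 + t C^2]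
    ([catalan_eq], [catalan_coef]). *)

(** * Cycles of a permutation multiplied by an involution *)

(* Cardinals are abstracted before calling [lia] because the occurrences of one
   cardinal may be equal only up to conversion. *)
Ltac card_lia :=
  repeat match goal with
  | H : context [card _] |- _ => move: H
  end;
  repeat match goal with
  | |- context [card ?A] => move: (card A)
  end; lia.

Section Cycles.
Variable T : finType.
Implicit Types (s al : {perm T}) (S : {set T}).
Local Open Scope group_scope.

Definition stable s S := forall x, (s x \in S) = (x \in S).

Definition moved al : {set T} := [set x | al x != x].

Lemma stable_porbit s S x y : stable s S -> y \in porbit s x ->
  (y \in S) = (x \in S).
Proof.
move=> sS /porbitP[i ->]; elim: i => [|i IH]; first by rewrite perm1.
by rewrite expgSr permM sS.
Qed.

Lemma porbit_stable s x : stable s (porbit s x).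
Proof.
move=> y; rewrite -!eq_porbit_mem; congr (_ == _).
by have := porbit_perm s 1 y; rewrite expg1.
Qed.

Lemma stable_tperm S a b : (a \in S) = (b \in S) -> stable (tperm a b) S.
Proof. by move=> ab x; case: tpermP => [->|->|]. Qed.

Lemma stableM s t S : stable s S -> stable t S -> stable (s * t) S.
Proof. by move=> sS tS x; rewrite permM tS sS. Qed.

(** An involution is a product of disjoint transpositions, one of which can be
    removed: this is the step of the inductions over the edges of a map. *)
Lemma involution_peel al a : involutive al -> al a != a ->
  exists al', [/\ involutive al', al = al' * tperm a (al a),
    forall x, x != a -> x != al a -> al' x = al x
    & (#|moved al'| + 2 = #|moved al|)%N].
Proof.
move=> alK na; exists (al * tperm a (al a)).
have E x : (al * tperm a (al a)) x =
    if (x == a) || (x == al a) then x else al x.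
  rewrite permM; case: eqP => [->|nxa] /=; first by rewrite tpermR.
  case: eqP => [->|nxb] /=; first by rewrite alK tpermL.
  by rewrite tpermD // eq_sym; [rewrite -(inj_eq (@perm_inj _ al)) alK|
    rewrite (inj_eq (@perm_inj _ al))]; apply/eqP.
split.
- move=> x; rewrite (E x); case: ifP => [xab|/norP[xa xb]]; first by rewrite E xab.
  by rewrite E (inj_eq (@perm_inj _ al)) (negbTE xa) -{1}[a]alK
             (inj_eq (@perm_inj _ al)) (negbTE xb) alK.
- by rewrite -mulgA tperm2 mulg1.
- by move=> x /negbTE xa /negbTE xb; rewrite E xa xb.
rewrite (cardsD1 a (moved al)) (cardsD1 (al a) (_ :\ a)) !inE na alK.
rewrite eq_sym na /= addnA addnC; congr (_ + _); apply: eq_card => x.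
by rewrite !inE E; case: (x == a); case: (x == al a); rewrite ?eqxx.
Qed.

Lemma involution_ind (P : {perm T} -> Prop) :
  P 1 ->
  (forall al al' a b, involutive al -> involutive al' -> a != b ->
     al = al' * tperm a b -> #|moved al| = #|moved al'|.+2 -> P al' -> P al) ->
  forall al, involutive al -> P al.
Proof.
move=> P1 PS al; have [n] := ubnP #|moved al|; elim: n al => // n IH al ltn alK.
have [/existsP[a na]|/existsPn fix_al] := boolP [exists a, al a != a].
  have [al' [al'K E _ c]] := involution_peel alK na.
  apply: (PS _ al' a (al a)) => //; rewrite 1?eq_sym //.
    by rewrite -c addn2.
  by apply: IH => //; lia.
suff -> : al = 1 by [].
by apply/permP => x; rewrite perm1; apply/eqP; rewrite -[_ == _]negbK.
Qed.

Lemma porbits_tperm_le s x y : (#|porbits (tperm x y * s)| <= #|porbits s|.+1)%N.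
Proof. by have /= := porbits_mul_tperm s x y; case: (x == y) => /=; lia. Qed.

(** Each of the [#|moved al| / 2] transpositions of [al] creates at most one
    cycle. *)
Lemma involution_porbits_le al s : involutive al ->
  (#|porbits (al * s)|.*2 <= #|porbits s|.*2 + #|moved al|)%N.
Proof.
move=> alK; elim/involution_ind: alK s => {al} [s|].
  by rewrite mul1g leq_addr.
move=> al al' a b _ _ _ -> -> IH s; rewrite -mulgA.
by have := IH (tperm a b * s); have := porbits_tperm_le s a b; card_lia.
Qed.

(** Transitivity of the group generated by [s] and [al], in the form that
    survives when transpositions are moved from [al] to [s]. *)
Definition connected s al :=
  forall S, stable s S -> stable al S -> S = set0 \/ S = setT.

(** The edges of a connected graph are at least its vertices minus one, and in
    a tree each edge joins two components.  A transposition whose points lie in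
    different cycles of [s] merges them and is moved into [s]; one whose points
    lie in the same cycle does not help to connect and is dropped, which makes
    the inequality strict. *)
Lemma connected_porbits al s : involutive al -> connected s al ->
  (#|porbits s|.*2 <= #|moved al| + 2)%N /\
  (#|porbits s|.*2 = #|moved al| + 2 -> #|porbits (al * s)| = 1)%N.
Proof.
move=> alK; elim/involution_ind: alK s => {al} [s conn|].
  have le1 : (#|porbits s| <= 1)%N.
    rewrite -(cards1 [set: T]); apply/subset_leq_card/subsetP => _ /imsetP[x _ ->].
    have [||P0|->] := conn (porbit s x); rewrite ?set11 //.
    - exact: porbit_stable.
    - by move=> y; rewrite perm1.
    - by have := porbit_id s x; rewrite {1}P0 in_set0.
  by rewrite mul1g; split; card_lia.
move=> al al' a b alK al'K ab E -> IH s conn; have /= := porbits_mul_tperm s a b.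
have /= := porbits_mul_tperm (tperm a b * s) a b.
rewrite mulgA tperm2 mul1g ab /=; set s1 := tperm a b * s.
have [a_in _|a_out] := boolP (a \in porbit s b).
  (* a and b are already joined by s, so the transposition is redundant. *)
  have [|le _] := IH s; last by split; card_lia.
  move=> S sS al'S; apply: conn => //; rewrite E; apply: stableM => //.
  by apply: stable_tperm; apply: (stable_porbit sS).
(* Otherwise s1 joins a and b in one cycle, so what is stable under s1 is
   stable under the transposition. *)
have [|a_in1] := boolP (a \in porbit s1 b) => /=; last by card_lia.
move=> a_in1 c1 _; have [|le eq1] := IH s1.
  move=> S s1S al'S; have tS : stable (tperm a b) S.
    by apply: stable_tperm; apply: (stable_porbit s1S).
  apply: conn => //; last by rewrite E; apply: stableM.
  by move=> x; rewrite -{1}[x](tpermK a b) -permM s1S tS.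
split; first by card_lia.
by move=> ?; rewrite E -mulgA; apply: eq1; card_lia.
Qed.

(** An invariant that takes [k] values on a permutation with at most [k] cycles
    separates the cycles. *)
Lemma porbits_labelled s (f : T -> nat) k :
  (forall x, f (s x) = f x) -> (forall j, (j < k)%N -> exists x, f x = j) ->
  (#|porbits s| <= k)%N -> (forall x, f x < k)%N ->
  #|porbits s| = k /\ forall x, porbit s x = [set y | f y == f x].
Proof.
move=> fs fsurj lek fk.
have forb x y : y \in porbit s x -> f y = f x.
  case/porbitP=> i ->; elim: i => [|i IH]; first by rewrite perm1.
  by rewrite expgSr permM fs.
have /fin_all_exists[p fp] : forall j : 'I_k, exists x, f x = j.
  by move=> j; apply: fsurj.
pose Q := [set porbit s (p j) | j : 'I_k].
have cQ : #|Q| = k.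
  rewrite card_imset ?card_ord // => i j eq_ij; apply: val_inj => /=.
  by rewrite -fp -(fp j); apply: forb; rewrite -eq_ij porbit_id.
have QP : Q = porbits s.
  apply/eqP; rewrite eqEcard cQ lek andbT.
  by apply/subsetP => _ /imsetP[j _ ->]; apply: imset_f.
split; first by rewrite -QP.
have key x : porbit s x = porbit s (p (Ordinal (fk x))).
  have : porbit s x \in Q by rewrite QP; apply: imset_f.
  case/imsetP => j _ E; rewrite E; congr (porbit s (p _)); apply: val_inj => /=.
  by rewrite -(fp j); apply: forb; rewrite E porbit_id.
move=> x; apply/setP => y; rewrite inE; apply/idP/eqP; first exact: forb.
move=> E; rewrite -eq_porbit_mem key (key x); apply/eqP.
by congr (porbit s (p _)); apply: val_inj.
Qed.

End Cycles.

(** * Noncrossing matchings and binary trees *)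

Inductive btree := Leaf | Node of btree & btree.

HB.instance Definition _ := gen_eqMixin btree.

Fixpoint bsize b := if b is Node l r then (bsize l + bsize r).+1 else 0.

(** The number of outermost arches of the associated matching. *)
Fixpoint spine b := if b is Node _ r then (spine r).+1 else 0.

(** The noncrossing involution of [0, ..., 2 bsize b - 1] in which [0] is joined
    to [2 bsize l + 1], the left subtree is drawn below this arch and the right
    subtree after it.  Values beyond the range have no meaning. *)
Fixpoint matching b i :=
  if b is Node l r then
    let k := (bsize l).*2.+1 in
    if i == 0 then k else if i < k then (matching l i.-1).+1
    else if i == k then 0 else k.+1 + matching r (i - k.+1)
  else i.

(** The vertex visited before step [i] of the contour of the plane tree of [b],
    for [i <= 2 bsize b].  The root is [0], the vertices below the first arch are
    [1, ..., bsize l + 1], and those of the right subtree, whose root is again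
    the root, come after them. *)
Fixpoint corner b i :=
  if b is Node l r then
    let k := (bsize l).*2.+1 in
    if i == 0 then 0 else if i <= k then (corner l i.-1).+1
    else let j := corner r (i - k.+1) in if j == 0 then 0 else (bsize l).+1 + j
  else 0.

(** Position of a step of the contour with respect to the first arch. *)
Variant contour_spec l r : nat -> Prop :=
  | ContourOpen : contour_spec l r 0
  | ContourInside i of i < (bsize l).*2 : contour_spec l r i.+1
  | ContourClose : contour_spec l r (bsize l).*2.+1
  | ContourAfter i of i < (bsize r).*2 : contour_spec l r ((bsize l).*2.+2 + i).

Lemma contourP l r i : i < (bsize (Node l r)).*2 -> contour_spec l r i.
Proof.
case: i => [|i] /= lti; first by constructor.
have [lt_il|lt_li|->] := ltngtP i (bsize l).*2; try by constructor.
have -> : i.+1 = (bsize l).*2.+2 + (i - (bsize l).*2.+1) by lia.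
by constructor; lia.
Qed.

Lemma matching_open l r : matching (Node l r) 0 = (bsize l).*2.+1.
Proof. by []. Qed.

Lemma matching_inside l r i : i < (bsize l).*2 ->
  matching (Node l r) i.+1 = (matching l i).+1.
Proof. by move=> lti; rewrite /= ltnS lti. Qed.

Lemma matching_close l r : matching (Node l r) (bsize l).*2.+1 = 0.
Proof. by rewrite /= ltnn eqxx. Qed.

Lemma matching_after l r i :
  matching (Node l r) ((bsize l).*2.+2 + i) = (bsize l).*2.+2 + matching r i.
Proof. by rewrite /= ifF ?ifF ?addKn //; lia. Qed.

Lemma corner0 b : corner b 0 = 0. Proof. by case: b. Qed.

Lemma corner_inside l r i : i <= (bsize l).*2 ->
  corner (Node l r) i.+1 = (corner l i).+1.
Proof. by move=> lei; rewrite /= ltnS lei. Qed.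

Lemma corner_after l r i : corner (Node l r) ((bsize l).*2.+2 + i) =
  if corner r i == 0 then 0 else (bsize l).+1 + corner r i.
Proof. by rewrite /= ifF ?addKn //; lia. Qed.

Arguments matching : simpl never.
Arguments corner : simpl never.

Lemma matchingP b i : i < (bsize b).*2 ->
  [/\ matching b i < (bsize b).*2, matching b (matching b i) = i
    & matching b i != i].
Proof.
elim: b i => // l IHl r IHr i /contourP[|{}i lti||{}i lti] /=.
- by rewrite matching_open matching_close; split=> //; lia.
- have [lt1 inv neq] := IHl i lti.
  by rewrite matching_inside // matching_inside // inv eqSS; split=> //; lia.
- by rewrite matching_close matching_open; split=> //; lia.
have [lt1 inv neq] := IHr i lti.
by rewrite !matching_after inv; split=> //; lia.
Qed.

Lemma matching_inj b b' : bsize b = bsize b' ->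
  (forall i, i < (bsize b).*2 -> matching b i = matching b' i) -> b = b'.
Proof.
elim: b b' => [|l IHl r IHr] [|l' r'] //= [eq_sz] eq_m.
have eql : bsize l = bsize l'.
  by have := eq_m 0 isT; rewrite !matching_open; lia.
congr Node; [apply: IHl => // i lti|apply: IHr => [|i lti]; first by lia].
  have := eq_m i.+1; rewrite !matching_inside -?eql // => E.
  by apply: succn_inj; apply: E; lia.
have := eq_m ((bsize l).*2.+2 + i).
rewrite matching_after eql matching_after => E.
by apply: (@addnI (bsize l').*2.+2); apply: E; lia.
Qed.

(** Without crossings, the positions strictly inside the first arch are matched
    among themselves, and so are those after it; shifted to start at [0], the
    two parts are the matchings of the left and right subtrees. *)
Lemma matching_surj n (m : nat -> nat) :
  (forall i, i < n -> [/\ m i < n, m (m i) = i & m i != i]) ->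
  (forall i j, i < j < m i -> j < n -> m i < n -> i < m j < m i) ->
  exists b, (bsize b).*2 = n /\ forall i, i < n -> matching b i = m i.
Proof.
have [N] := ubnP n; elim: N n m => // N IH [|n] m ltn mP noX.
  by exists Leaf.
set k := m 0; have [ltk mk nk] := mP 0 isT; rewrite -/k in ltk mk nk.
have inside i : 0 < i < k -> 0 < m i < k by move=> ?; apply: (noX 0 i); lia.
have outside i : k < i <= n -> k < m i <= n.
  move=> ik; have [lti mi ni] : [/\ m i < n.+1, m (m i) = i & m i != i].
    by apply: mP; lia.
  have : m i != 0 by apply: contraTneq ik => E; move: mi; rewrite E -/k; lia.
  have : m i != k by apply: contraTneq ik => E; move: mi; rewrite E mk; lia.
  have := inside (m i); rewrite mi; lia.
have [|||l [szl lP]] := IH k.-1 (fun i => (m i.+1).-1).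
- by lia.
- move=> i lti; have m_in : 0 < m i.+1 < k by apply: inside; lia.
  have [|lt1 inv neq] := mP i.+1; first by lia.
  have -> : (m i.+1).-1.+1 = m i.+1 by lia.
  by rewrite inv; split; lia.
- move=> i j ij ltj lti; have := noX i.+1 j.+1; have := inside i.+1.
  have := inside j.+1; lia.
have [|||r [szr rP]] := IH (n - k) (fun i => m (i + k.+1) - k.+1).
- by lia.
- move=> i lti; have m_out : k < m (i + k.+1) <= n by apply: outside; lia.
  have [|lt1 inv neq] := mP (i + k.+1); first by lia.
  have -> : m (i + k.+1) - k.+1 + k.+1 = m (i + k.+1) by lia.
  by rewrite inv; split; lia.
- move=> i j ij ltj lti; have := noX (i + k.+1) (j + k.+1).
  have := outside (i + k.+1); have := outside (j + k.+1); lia.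
exists (Node l r); split=> [/=|i]; first by lia.
have szk : (bsize l).*2.+1 = k by lia.
have -> : n.+1 = (bsize (Node l r)).*2 by move=> /=; lia.
case/contourP=> [|{}i lti||{}i lti].
- by rewrite matching_open szk.
- rewrite matching_inside // lP; last by lia.
  by have := inside i.+1; lia.
- by rewrite matching_close szk mk.
rewrite matching_after rP; last by lia.
rewrite szk [in RHS]addnC; have := outside (i + k.+1); lia.
Qed.

Lemma corner_end b : corner b (bsize b).*2 = 0.
Proof.
elim: b => // l _ r IHr.
have -> : (bsize (Node l r)).*2 = (bsize l).*2.+2 + (bsize r).*2 by move=> /=; lia.
by rewrite corner_after IHr.
Qed.

(** Following an edge and then the edge that comes next in the contour of the
    face turns around a vertex: [corner] is invariant under the vertex
    permutation. *)
Lemma corner_matching b i : i < (bsize b).*2 ->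
  corner b (matching b i).+1 = corner b i.
Proof.
elim: b i => // l IHl r IHr i /contourP[|{}i lti||{}i lti].
- by rewrite matching_open -[_.+2]addn0 corner_after !corner0.
- have [lt1 _ _] := matchingP lti.
  by rewrite matching_inside // !corner_inside ?IHl // ltnW.
- by rewrite matching_close !corner_inside // corner0 corner_end.
by rewrite matching_after -addnS !corner_after IHr.
Qed.

Lemma corner_le b i : i < (bsize b).*2 -> corner b i <= bsize b.
Proof.
elim: b i => // l IHl r IHr i /contourP[|{}i lti||{}i lti] /=.
- by rewrite corner0.
- by rewrite corner_inside ?(ltnW lti); have := IHl i lti; lia.
- by rewrite corner_inside // corner_end.
by rewrite corner_after; have := IHr i lti; case: ifP; lia.
Qed.

Lemma corner_onto b j : j <= bsize b ->
  exists2 i, i <= (bsize b).*2 & corner b i = j.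
Proof.
elim: b j => [|l IHl r IHr] j /= lej; first by exists 0 => //; rewrite corner0; lia.
have [->|j0] := eqVneq j 0; first by exists 0; rewrite ?corner0.
have [lejl|ltlj] := leqP j (bsize l).+1.
  have [|i lei ci] := IHl j.-1; first by lia.
  by exists i.+1; [lia|rewrite corner_inside // ci; lia].
have [|i lei ci] := IHr (j - (bsize l).+1); first by lia.
by exists ((bsize l).*2.+2 + i); [lia|rewrite corner_after ci; case: ifP; lia].
Qed.

(** The last corner is the first one again and can be left out. *)
Lemma corner_onto_lt b j : 0 < bsize b -> j <= bsize b ->
  exists2 i, i < (bsize b).*2 & corner b i = j.
Proof.
move=> b0 /corner_onto[i]; rewrite leq_eqVlt => /orP[/eqP->|lti ci]; last by exists i.
by rewrite corner_end => <-; exists 0; [lia|rewrite corner0].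
Qed.

Lemma count_root_corner b :
  count (fun i => corner b i == 0) (iota 0 (bsize b).*2) = spine b.
Proof.
elim: b => // l _ r IHr.
have -> : (bsize (Node l r)).*2 = 1 + (bsize l).*2.+1 + (bsize r).*2.
  by move=> /=; lia.
rewrite !iotaD !count_cat add0n [RHS]/= -IHr -[RHS]add1n; congr (_ + _).
  rewrite -[RHS]addn0; congr (_ + _).
  apply/eqP; rewrite -leqn0 leqNgt -has_count; apply/hasPn => i.
  by rewrite mem_iota => ?; rewrite -[i]prednK ?corner_inside; lia.
rewrite addnC iotaDl count_map; apply: eq_count => i /=.
by rewrite corner_after; case: (corner r i).
Qed.

Lemma spine_le b : spine b <= bsize b.
Proof. by elim: b => //= l _ r IH; lia. Qed.

(** * The list of binary trees of a given size *)

(** [N] is fuel: the recursive calls are on sizes smaller than [e], which are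
    not structural subterms. *)
Fixpoint trees_rec N e : seq btree :=
  if N is N'.+1 then
    if e is e'.+1 then
      [seq Node lr.1 lr.2 | i <- iota 0 e,
         lr <- [seq (l, r) | l <- trees_rec N' i, r <- trees_rec N' (e' - i)]]
    else [:: Leaf]
  else [::].

Definition trees e := trees_rec e.+1 e.

Lemma trees_recS N e : trees_rec N.+1 e.+1 =
  [seq Node lr.1 lr.2 | i <- iota 0 e.+1,
     lr <- [seq (l, r) | l <- trees_rec N i, r <- trees_rec N (e - i)]].
Proof. by []. Qed.

Lemma trees_rec_fuel N e : e < N -> trees_rec N e = trees e.
Proof.
have [K] := ubnP e; elim: K N e => // K IH [//|N] [//|e] ltK ltN.
rewrite /trees !trees_recS; congr flatten; apply/eq_in_map => i.
by rewrite mem_iota => lti; rewrite !IH //; lia.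
Qed.

Lemma treesS e : trees e.+1 =
  [seq Node lr.1 lr.2 | i <- iota 0 e.+1,
     lr <- [seq (l, r) | l <- trees i, r <- trees (e - i)]].
Proof.
rewrite {1}/trees trees_recS; congr flatten; apply/eq_in_map => i.
by rewrite mem_iota => lti; rewrite !trees_rec_fuel //; lia.
Qed.

Lemma mem_trees b e : (b \in trees e) = (bsize b == e).
Proof.
elim: b e => [|l IHl r IHr] [|e] /=.
- by rewrite inE eqxx.
- rewrite treesS; apply/negbTE/negP.
  by case/allpairsPdep=> [i [lr [_ _ E]]].
- by rewrite inE; apply/negbTE/eqP.
rewrite treesS; apply/allpairsPdep/eqP => [[i [lr [+ + E]]]|[E]].
  rewrite mem_iota => /andP[_ lti] /allpairsP[[u v] [/= ui vi E']].
  move: E; rewrite E' /= => - [El Er].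
  by move: ui vi; rewrite -El -Er IHl IHr; lia.
exists (bsize l), (l, r); rewrite mem_iota; split=> //; first by lia.
apply/allpairsP; exists (l, r) => /=; rewrite IHl IHr; split=> //; lia.
Qed.

Lemma trees_uniq e : uniq (trees e).
Proof.
have [N] := ubnP e; elim: N e => // N IH [//|e] lte.
rewrite treesS; apply: allpairs_uniq_dep => [|i|].
- exact: iota_uniq.
- rewrite mem_iota => lti; apply: allpairs_uniq; try (apply: IH; lia).
  by move=> [? ?] [? ?] _ _ [-> ->].
move=> _ _ /allpairsPdep[i [u [_ ui ->]]] /allpairsPdep[j [v [_ vj ->]]] /=.
case/allpairsP: ui => [[u1 u2] [/= m1 _ ->]].
case/allpairsP: vj => [[v1 v2] [/= n1 _ ->]] [E1 E2].
move: m1 n1; rewrite E1 E2 !mem_trees => /eqP<- /eqP E.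
by subst j.
Qed.

(** * Labelling by the iterates of a one-cycle permutation *)

Section Walk.
Variables (H : finType) (phi : {perm H}) (r : H).
Hypothesis phi_trans : forall h, h \in porbit phi r.

Definition pos h := index h (traject phi r #|H|).

Lemma porbit_full : porbit phi r = setT.
Proof. by apply/setP => h; rewrite inE phi_trans. Qed.

Lemma walk_uniq : uniq (traject phi r #|H|).
Proof. by have := uniq_traject_porbit phi r; rewrite porbit_full cardsT. Qed.

Lemma walk_mem h : h \in traject phi r #|H|.
Proof. by rewrite -cardsT -porbit_full -porbit_traject. Qed.

Lemma pos_lt h : pos h < #|H|.
Proof. by rewrite -[X in _ < X](size_traject phi r) index_mem walk_mem. Qed.

Lemma iter_pos h : iter (pos h) phi r = h.
Proof. by rewrite -(nth_traject phi (pos_lt h)) nth_index ?walk_mem. Qed.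

Lemma pos_iter i : i < #|H| -> pos (iter i phi r) = i.
Proof.
by move=> lti; rewrite /pos -(nth_traject phi lti) index_uniq ?size_traject ?walk_uniq.
Qed.

Lemma iter_walk : iter #|H| phi r = r.
Proof. by have := iter_porbit phi r; rewrite porbit_full cardsT. Qed.

Lemma pos_step h : pos (phi h) = if (pos h).+1 == #|H| then 0 else (pos h).+1.
Proof.
have lt := pos_lt h; rewrite -{1}(iter_pos h) -iterS; case: eqP => [->|ne].
  by rewrite iter_walk (pos_iter (i := 0)) //; apply: leq_ltn_trans lt.
by rewrite pos_iter //; lia.
Qed.

Lemma card_porbits_walk : #|porbits phi| = 1.
Proof.
rewrite -(cards1 (porbit phi r)); apply: eq_card => A; rewrite inE.
apply/imsetP/eqP => [[h _ ->]|->]; last by exists r.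
by apply/eqP; rewrite eq_porbit_mem.
Qed.

End Walk.

(** * Rooted maps coded by binary trees *)

Section Codes.
Local Open Scope group_scope.

(** The face permutation [al * si] is one cycle and, in the labelling of the
    half-edges by its iterates from the root, [al] is the matching of [b]. *)
Definition codes (b : btree) (H : finType) (T : rooted_map H) :=
  let: (al, si, r) := T in
  [/\ (#|H| = (bsize b).*2)%N, forall h, h \in porbit (al * si) r
    & forall i, (i < #|H|)%N ->
      al (iter i (al * si) r) = iter (matching b i) (al * si) r].

Lemma codes_pos b (H : finType) (al si : {perm H}) r h : codes b (al, si, r) ->
  pos (al * si) r (al h) = matching b (pos (al * si) r h).
Proof.
move=> [cH tr alE]; have lt := pos_lt tr h; have := alE _ lt.
rewrite iter_pos // => ->; rewrite pos_iter // cH.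
by have [|] := @matchingP b (pos (al * si) r h); rewrite -?cH.
Qed.

Lemma codes_involutive b (H : finType) (al si : {perm H}) r :
  codes b (al, si, r) -> forall h, al (al h) = h /\ al h != h.
Proof.
move=> co h; have [cH tr _] := co.
have [|_ inv neq] := @matchingP b (pos (al * si) r h).
  by rewrite -cH pos_lt.
split.
  by rewrite -[LHS](iter_pos tr) !(codes_pos _ co) inv iter_pos.
by apply: contraNneq neq => E; rewrite -(codes_pos _ co) E.
Qed.

Lemma codes_inj b b' (H : finType) (T : rooted_map H) :
  codes b T -> codes b' T -> b = b'.
Proof.
case: T => [[al si] r] co co'; have [cH tr _] := co; have [cH' _ _] := co'.
apply: matching_inj => [|i]; first by lia.
by rewrite -cH => lti; rewrite -(pos_iter tr lti) -!codes_pos.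
Qed.

Lemma codes_transport b (H H' : finType) (T : rooted_map H) (T' : rooted_map H') :
  rooted_iso T T' -> codes b T -> codes b T'.
Proof.
case: T T' => [[al si] r] [[al' si'] r'] [f bf [fa fs fr]] [cH tr alE].
have fw i : f (iter i (al * si) r) = iter i (al' * si') r'.
  by elim: i => [|i IH] //; rewrite !iterS !permM fs fa IH.
have cH' : #|H'| = #|H| by rewrite (bij_eq_card bf).
split=> [|h'|i lti]; first by rewrite cH'.
  case: bf => g fK gK; have /porbitP[i E] := tr (g h').
  by apply/porbitP; exists i; rewrite -[LHS]gK E !permX fw.
by rewrite -!fw -fa alE // -cH'.
Qed.

(** Sending the [i]-th half-edge of one contour to the [i]-th half-edge of the
    other commutes with [al] and with [al * si], hence with [si]. *)
Lemma codes_iso b (H H' : finType) (T : rooted_map H) (T' : rooted_map H') :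
  codes b T -> codes b T' -> rooted_iso T T'.
Proof.
case: T T' => [[al si] r] [[al' si'] r'] co co'.
have [cH tr alE] := co; have [cH' tr' alE'] := co'.
have eqH : #|H| = #|H'| by rewrite cH cH'.
pose f h := iter (pos (al * si) r h) (al' * si') r'.
pose g h := iter (pos (al' * si') r' h) (al * si) r.
have fal h : f (al h) = al' (f h).
  by rewrite /f (codes_pos _ co) alE' // -eqH pos_lt.
have fphi h : f ((al * si) h) = (al' * si') (f h).
  rewrite /f pos_step // -[RHS]iterS; case: eqP => // ->.
  by rewrite eqH iter_walk.
exists f; first exists g.
- by move=> h; rewrite /g /f pos_iter ?iter_pos // -eqH pos_lt.
- by move=> h; rewrite /g /f pos_iter ?iter_pos // eqH pos_lt.
split=> // [h|].
  have := fphi (al h); rewrite !permM fal.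
  by rewrite (codes_involutive co h).1 (codes_involutive co' _).1.
rewrite /f (_ : pos _ _ _ = 0%N) //.
have := pos_iter tr (i := 0); apply; exact: leq_ltn_trans (pos_lt tr r).
Qed.

(** On [0, ..., 2 bsize b - 1], take for [si] the matching followed by the cyclic
    shift, so that the face permutation is the shift. *)
Lemma codes_exist b : (0 < bsize b)%N ->
  exists T : rooted_map 'I_(2 * bsize b), codes b T.
Proof.
move=> b0; have n0 : (0 < 2 * bsize b)%N by lia.
have lt_m (i : 'I_(2 * bsize b)) : (matching b i < 2 * bsize b)%N.
  by have [|] := @matchingP b i; rewrite -mul2n.
pose m i := Ordinal (lt_m i).
have mK : involutive m.
  move=> i; apply: val_inj => /=.
  by have [|] := @matchingP b i; rewrite -?mul2n.
pose c : {perm 'I_(2 * bsize b)} := perm (@ordS_inj _).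
pose al := perm (inv_inj mK); pose r := Ordinal n0.
have phiE : al * (al * c) = c.
  by apply/permP => i; rewrite !permM !permE mK.
have iterc i : (i < 2 * bsize b)%N -> iter i c r = i :> nat.
  elim: i => // i IH lti; rewrite iterS permE /= IH; last exact: ltnW.
  by rewrite modn_small.
exists (al, al * c, r); rewrite /codes phiE card_ord;
  split=> [|h|i lti]; first by rewrite mul2n.
  apply/porbitP; exists h; rewrite permX.
  by apply: val_inj; rewrite /= iterc.
have [|lt_mi _ _] := @matchingP b i; first by rewrite -mul2n.
by apply: val_inj; rewrite permE /= !iterc // mul2n.
Qed.

(** [corner] takes [e + 1] values and is constant on the cycles of [si]; as the
    face permutation has one cycle and [al] has [e] transpositions, [si] has at
    most [e + 1] cycles.  So the cycles are exactly the classes of corners, and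
    the root degree is the number of corners labelled [0]. *)
Lemma codes_tree b e (H : finType) (al si : {perm H}) r :
  (0 < e)%N -> bsize b = e -> codes b (al, si, r) ->
  plane_tree e al si /\ #|porbit si r| = spine b.
Proof.
move=> e0 sb co; have [cH tr alE] := co; have inv := codes_involutive co.
have alK : involutive al by move=> h; have [] := inv h.
pose f h := corner b (pos (al * si) r h).
have lt_pos h : (pos (al * si) r h < (bsize b).*2)%N by rewrite -cH pos_lt.
have fsi h : f (si h) = f h.
  have -> : si h = (al * si) (al h) by rewrite permM alK.
  rewrite /f pos_step // (codes_pos _ co) -[RHS]corner_matching //.
  by case: eqP => // ->; rewrite cH corner_end corner0.
have lt_f h : (f h < e.+1)%N by rewrite ltnS -sb corner_le.
have onto j : (j < e.+1)%N -> exists h, f h = j.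
  rewrite ltnS -sb => /corner_onto_lt[|i lti <-]; first by rewrite sb.
  by exists (iter i (al * si) r); rewrite /f pos_iter // cH.
have moved_al : moved al = setT.
  by apply/setP => h; rewrite !inE (inv h).2.
have le_si : (#|porbits si| <= e.+1)%N.
  have := involution_porbits_le (al * si) alK.
  rewrite mulgA (_ : al * al = 1); last by apply/permP => h; rewrite permM perm1 alK.
  rewrite mul1g (card_porbits_walk tr) moved_al cardsT cH sb.
  card_lia.
have [c_si si_orb] := porbits_labelled fsi onto le_si lt_f.
split.
  apply/and5P; split=> //.
  - by rewrite cH sb mul2n.
  - by apply/forallP => h; have [-> ->] := inv h; rewrite eqxx.
  - apply/imsetP; exists r => //; apply/esym/setP => h; rewrite inE.
    have /porbitP[i ->] := tr h; apply: mem_orbit.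
    by apply: groupX; apply: groupM; apply: mem_gen; rewrite !inE eqxx ?orbT.
  - by rewrite c_si.
have f_r : f r = 0%N.
  by rewrite /f (pos_iter (i := 0) tr) ?corner0 // cH sb; lia.
rewrite si_orb f_r -count_root_corner -cH.
transitivity (count (fun i => corner b i == 0%N)
    [seq pos (al * si) r h | h <- traject (al * si) r #|H|]); last first.
  congr (count _ _); apply: (@eq_from_nth _ 0%N).
    by rewrite size_map size_traject size_iota.
  move=> i; rewrite size_map size_traject => lti.
  by rewrite (nth_map r) ?size_traject // nth_traject // pos_iter // nth_iota.
rewrite count_map -size_filter -(card_uniqP _); last first.
  by rewrite filter_uniq // walk_uniq.
by apply: eq_card => h; rewrite !inE mem_filter walk_mem // andbT.
Qed.

Lemma tree_face e (H : finType) (al si : {perm H}) r : plane_tree e al si ->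
  forall h, h \in porbit (al * si) r.
Proof.
move=> + h; case/and5P => e0 /eqP cH /forallP inv tr /eqP csi.
have alK : involutive al by move=> u; have /andP[/eqP] := inv u.
have [|_] := @connected_porbits _ al si alK.
  move=> S sS aS; have [->|[x xS]] := set_0Vmem S; [by left | right].
  apply/setP => y; rewrite inE.
  have act : <<[set al; si]>> \subset 'N(S | 'P).
    rewrite gen_subG; apply/subsetP => u; rewrite !inE => /orP[]/eqP-> /=;
    by apply/subsetP => z; rewrite inE /= /aperm ?aS ?sS.
  have : y \in orbit 'P <<[set al; si]>> x by rewrite (atransP tr) ?inE.
  case/orbitP => u uG <-; rewrite (astabs_act _ (subsetP act u uG)).
  by rewrite xS.
have -> : moved al = setT.
  by apply/setP => u; rewrite !inE; have /andP[] := inv u.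
rewrite cardsT cH csi => one_face.
have /eqP/cards1P[A EA] : #|porbits (al * si)| = 1%N by apply: one_face; lia.
rewrite -eq_porbit_mem.
have : porbit (al * si) h \in porbits (al * si) by apply: imset_f.
have : porbit (al * si) r \in porbits (al * si) by apply: imset_f.
by rewrite EA !inE => /eqP-> /eqP->.
Qed.

(** If the arches [{a, al a}] and [{x, al x}] crossed, the first would cut the
    face into two cycles and the second would glue them back into one; the other
    [e - 2] transpositions would then lead to at most [e - 1] vertices. *)
Lemma tree_noncrossing e (H : finType) (al si : {perm H}) r a x :
  plane_tree e al si ->
  (pos (al * si) r a < pos (al * si) r x < pos (al * si) r (al a))%N ->
  (pos (al * si) r a < pos (al * si) r (al x) < pos (al * si) r (al a))%N.
Proof.
move=> pt; have tr := tree_face r pt; move: (pt).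
set phi := al * si; pose p := pos phi r; rewrite -!/(p _).
case/and5P => e0 /eqP cH /forallP inv _ /eqP csi ax.
apply: contraT => out.
have alK : involutive al by move=> h; have /andP[/eqP] := inv h.
have neq h : al h != h by have /andP[] := inv h.
have moved_al : moved al = setT by apply/setP => h; rewrite !inE neq.
have xa : x != a by apply: contraTneq ax => ->; rewrite ltnn.
have xb : x != al a by apply: contraTneq ax => ->; rewrite ltnn andbF.
have [al1 [al1K E1 al1x c1]] := involution_peel alK (neq a).
have al1_x : al1 x = al x by apply: al1x.
have nx : al1 x != x by rewrite al1_x.
have [al2 [al2K E2 _ c2]] := involution_peel al1K nx.
rewrite al1_x in E2.
have eq_si : si = al2 * (tperm x (al x) * (tperm a (al a) * phi)).
  rewrite /phi !mulgA -E2 -E1 -mulgA; apply/permP => h.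
  by rewrite !permM alK.
(* The two cycles of the face cut along the first arch; [f] tells them apart. *)
pose f h := ((p a < p h) && (p h <= p (al a)))%N.
have sep h : f ((tperm a (al a) * phi) h) = f h.
  have lt_h u : (p u < #|H|)%N by apply: pos_lt.
  rewrite permM /f /p pos_step // -!/(p _).
  have lt1 := lt_h h; have lt2 := lt_h (al a).
  case: tpermP => [->|->|na nb]; try (case: eqP; lia).
  have : p h != p a by apply: contra_notN na => /eqP; move/(can_inj (iter_pos tr)).
  have : p h != p (al a) by apply: contra_notN nb => /eqP; move/(can_inj (iter_pos tr)).
  by case: (_ =P #|H|); lia.
have sep_orb h u : u \in porbit (tperm a (al a) * phi) h -> f u = f h.
  case/porbitP => i ->; elim: i => [|i IH]; first by rewrite perm1.
  by rewrite expgSr permM sep.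
have face_cut : #|porbits (tperm a (al a) * phi)| = 2.
  have /= := porbits_mul_tperm phi a (al a).
  have -> : a \in porbit phi (al a).
    by have := tree_face (al a) pt; apply.
  by rewrite (card_porbits_walk tr) eq_sym neq; lia.
have x_cut : x \notin porbit (tperm a (al a) * phi) (al x).
  apply: contra out => /sep_orb; rewrite /f.
  have : p (al x) != p (al a).
    apply: contra_notN (elimN eqP xa) => /eqP.
    by move=> /(can_inj (iter_pos tr)) /perm_inj.
  lia.
have /= := porbits_mul_tperm (tperm a (al a) * phi) x (al x).
rewrite x_cut face_cut eq_sym neq => c3.
have := involution_porbits_le (tperm x (al x) * (tperm a (al a) * phi)) al2K.
rewrite -eq_si csi; move: c1; rewrite moved_al cardsT cH; move: c2 c3.
card_lia.
Qed.

Lemma tree_codes e (H : finType) (T : rooted_map H) : one_rooted_tree e T ->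
  exists2 b, bsize b = e & codes b T.
Proof.
case: T => [[al si] r] pt; have tr := tree_face r pt.
have /and5P[_ /eqP cH /forallP inv _ _] := pt.
have alK : involutive al by move=> h; have /andP[/eqP] := inv h.
pose m i := pos (al * si) r (al (iter i (al * si) r)).
have [i lti|i j ij ltj lti|b [sb bE]] := @matching_surj #|H| m.
- rewrite /m iter_pos // alK pos_iter //; split=> //; first exact: pos_lt.
  have /andP[_ /eqP ne] := inv (iter i (al * si) r).
  by apply/eqP => E; apply: ne; rewrite -{2}E iter_pos.
- pose w k := iter k (al * si) r.
  have := @tree_noncrossing e H al si r (w i) (w j) pt.
  by rewrite !pos_iter //; [apply | lia].
exists b; first by lia.
split=> // i lti; by rewrite bE // /m iter_pos.
Qed.

End Codes.

(** * Isomorphism classes are counted by binary trees *)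

Lemma card_classes (T : finType) (B : eqType) (R : rel T) (D : {set T})
    (code : B -> T -> Prop) (L : seq B) :
  uniq L ->
  (forall x, x \in D -> exists2 b, b \in L & code b x) ->
  (forall b, b \in L -> exists2 x, x \in D & code b x) ->
  (forall b x y, code b x -> R x y <-> code b y) ->
  (forall b b' x, code b x -> code b' x -> b = b') ->
  #|equivalence_partition R D| = size L.
Proof.
move=> uL DL LD codeR code_inj.
pose cls b := [set x in D | `[< code b x >]].
have clsE b x : code b x -> [set y in D | R x y] = cls b.
  move=> cx; apply/setP => y; rewrite !inE; congr (_ && _).
  by apply/idP/asboolP => /(codeR _ _ _ cx).
have -> : #|equivalence_partition R D| = size [seq cls b | b <- L].
  rewrite -(card_uniqP _); last first.
    rewrite map_inj_in_uniq // => b b' bL _ E.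
    have [x xD cx] := LD b bL; have : x \in cls b by rewrite inE xD; apply/asboolP.
    by rewrite E inE => /andP[_ /asboolP]; apply: code_inj.
  apply: eq_card => A; apply/imsetP/mapP => [[x xD ->]|[b bL ->]].
    by have [b bL cx] := DL x xD; exists b => //; apply: clsE.
  by have [x xD cx] := LD b bL; exists x => //; rewrite -(clsE _ _ cx).
by rewrite size_map.
Qed.

(** Every tree has exactly one code and two maps with the same code are
    isomorphic, so isomorphism classes are in bijection with codes. *)
Lemma T1_count e d : T1 e d = count (fun b => spine b == d) (trees e).
Proof.
rewrite /T1; case: eqP => [->|/eqP e0].
  by rewrite /= addn0 eq_sym.
rewrite -lt0n in e0; rewrite -size_filter.
apply: (card_classes (code := fun b T => codes b T)).
- by rewrite filter_uniq // trees_uniq.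
- move=> [[al si] r]; rewrite inE => /andP[pt /eqP dg].
  have [b sb co] := tree_codes pt; exists b => //.
  have [_ sp] := codes_tree e0 sb co.
  by rewrite mem_filter mem_trees sb -sp -dg !eqxx.
- move=> b; rewrite mem_filter mem_trees => /andP[/eqP sd /eqP sb].
  have [|T co] := @codes_exist b; first by rewrite sb.
  move: T co; rewrite sb => -[[al si] r] co; exists (al, si, r) => //.
  have [pt sp] := codes_tree e0 sb co.
  by rewrite inE /= pt sp sd eqxx.
- move=> b T T' co; split=> [/asboolP iso|co']; first exact: codes_transport co.
  by apply/asboolP; apply: codes_iso co'.
by move=> b b' T; apply: codes_inj.
Qed.

(** * Generating functions *)

Import GRing.Theory.
Local Open Scope ring_scope.

Lemma G1_coef e : G1 e = \sum_(b <- trees e) 'X^(spine b).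
Proof.
rewrite /= (eq_bigr (fun d : 'I_e.+1 =>
    \sum_(b <- trees e) (spine b == d)%:R *: 'X^d)) => [|d _]; last first.
  by rewrite T1_count -sum1_count natr_sum scaler_suml big_mkcond;
     apply: eq_bigr => b _; case: eqP; rewrite ?scale0r.
rewrite exchange_big big_seq [RHS]big_seq; apply: eq_bigr => b.
rewrite mem_trees => /eqP sb; have ltb : (spine b < e.+1)%N.
  by rewrite ltnS -sb spine_le.
rewrite (bigD1 (Ordinal ltb)) //= eqxx scale1r big1 ?addr0 // => d.
by rewrite -val_eqE /= eq_sym => /negbTE ->; rewrite scale0r.
Qed.

Lemma tvar_coefS (a : fps {poly rat}) n : (tvar * a) n.+1 = a n.
Proof.
rewrite fps_coefM !big_ord_recl /= mul0r add0r mul1r subn1 /= big1 ?addr0 //.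
by move=> i _; rewrite mul0r.
Qed.

Lemma xvar_coef (a : fps {poly rat}) n : (xvar * a) n = 'X * a n.
Proof.
rewrite fps_coefM !big_ord_recl /= subn0 big1 ?addr0 //.
by move=> i _; rewrite mul0r.
Qed.

Lemma tvar_inj : injective ( *%R tvar).
Proof.
by move=> a b E; apply/fpsP => n; rewrite -!(tvar_coefS _ n) E.
Qed.

(** Squaring [2 t C = 1 - sqrt (1 - 4 t)] gives [4 t (C - 1 - t C^2) = 0]. *)
Lemma catalan_eq : catalan = 1 + tvar * catalan ^+ 2.
Proof.
have u4 : (2%:R * 2%:R : fps {poly rat}) \is a GRing.unit.
  by rewrite unitrM fps2_unit.
apply: tvar_inj; apply: (mulrI u4).
have SE : sqrt_1_4t = 1 - 2%:R * tvar * catalan by rewrite catalanE; ring.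
have := sqrt_1_4t_sqr; rewrite SE => E.
apply/eqP; rewrite -subr_eq0; apply/eqP.
transitivity ((1 - 4%:R * tvar) - (1 - 2%:R * tvar * catalan) ^+ 2); first by ring.
by rewrite E subrr.
Qed.

Lemma catalan_coef e : catalan e = (size (trees e))%:R.
Proof.
have [N] := ubnP e; elim: N e => // N IH [|e] lte.
  rewrite catalan_eq fps_coefD fps_coef1 fps_coef0M.
  by rewrite (_ : tvar 0%N = 0) // mul0r addr0.
rewrite catalan_eq fps_coefD fps_coef1 add0r tvar_coefS expr2 fps_coefM.
rewrite treesS size_allpairs_dep sumnE big_map natr_sum.
rewrite -[iota 0 e.+1]/(index_iota 0 e.+1) big_mkord.
apply: eq_bigr => i _; have := ltn_ord i => lti.
by rewrite size_allpairs natrM !IH //; lia.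
Qed.

(** A nonempty binary tree is a left subtree, of which only the size counts, and
    a right subtree whose spine is one shorter. *)
Lemma G1_eq : G1 = 1 + tvar * xvar * catalan * G1.
Proof.
apply/fpsP => -[|e].
  by rewrite G1_coef big_seq1 fps_coefD fps_coef1 !fps_coef0M !mul0r addr0.
rewrite fps_coefD fps_coef1 add0r -!mulrA tvar_coefS xvar_coef fps_coefM.
rewrite G1_coef treesS big_allpairs_dep.
rewrite -[iota 0 e.+1]/(index_iota 0 e.+1) big_mkord.
rewrite mulr_sumr; apply: eq_bigr => i _.
rewrite big_allpairs catalan_coef G1_coef.
transitivity (\sum_(l <- trees i)
  'X * \sum_(r <- trees (e - i)) ('X^(spine r) : {poly rat})).
  apply: eq_bigr => l _; rewrite mulr_sumr; apply: eq_bigr => r _.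
  by rewrite -exprS.
by rewrite big_const_seq count_predT iter_addr_0 -[LHS]mulr_natl mulrCA.
Qed.

Theorem mainTheorem9 :
  G1 = (1 - tvar * xvar * catalan)^-1 /\
  (1 - tvar * xvar * catalan)^-1
    = (1 + sqrt_1_4t) / (1 + sqrt_1_4t - 2%:R * xvar * tvar).
Proof.
split.
  apply: (mulrI denom1_unit); rewrite mulrV ?denom1_unit //.
  by rewrite mulrBl mul1r {1}G1_eq addrK.
apply: (mulrI denom1_unit); rewrite mulrV ?denom1_unit //.
apply: (mulIr denom2_unit); rewrite mul1r mulrA divrK ?denom2_unit //.
have SE : sqrt_1_4t = 1 - 2%:R * tvar * catalan by rewrite catalanE; ring.
have tCS : tvar * catalan * (1 + sqrt_1_4t) = 2%:R * tvar.
  apply: (mulrI fps2_unit).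
  have -> : 2%:R * (tvar * catalan * (1 + sqrt_1_4t)) =
    (2%:R * tvar * catalan) * (1 + sqrt_1_4t) by ring.
  rewrite catalanE.
  have -> : (1 - sqrt_1_4t) * (1 + sqrt_1_4t) = 1 - sqrt_1_4t ^+ 2 by ring.
  by rewrite sqrt_1_4t_sqr; ring.
have -> : 2%:R * xvar * tvar = xvar * (2%:R * tvar) by ring.
by rewrite -tCS; ring.
Qed.
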